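(* Let $n\ge1$, let $X(t)$, $t\in\mathbb{R}^n$, be a stationary random field, let $H>0$, and let $Y(t)$, $t\in\mathbb{R}_+^n$, be its $H$-Lamperti transform $$Y(t)=\Vert t\Vert^{H}X(\ln t_1,\dots,\ln t_n).$$ Then $Y$ is an $H$-self-similar field.
   Context: $\mathbb{R}_+$ is the set of positive reals and $\Vert\cdot\Vert$ is the Euclidean norm. A random field $X(t)$, $t\in\mathbb{R}^n$, is stationary if for every $u\in\mathbb{R}^n$ the fields $\{X(t+u)\}_t$ and $\{X(t)\}_t$ have the same finite-dimensional distributions. A random field $Y(t)$, $t\in\mathbb{R}_+^n$, is $H$-self-similar if for every $c>0$ the fields $\{Y(ct)\}_t$ and $\{c^HY(t)\}_t$ have the same finite-dimensional distributions. *)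

(* Defs.v *)
From HB Require Import structures.
From mathcomp Require Import all_boot all_order all_algebra.
From mathcomp Require Import all_classical all_reals all_analysis.
From mathcomp Require Import measurable_realfun.

Set Implicit Arguments.
Unset Strict Implicit.
Unset Printing Implicit Defensive.

Import Order.TTheory GRing.Theory Num.Theory.
Import numFieldNormedType.Exports.
Local Open Scope classical_set_scope.
Local Open Scope ring_scope.

(* A real random field indexed by a type I is a family X : I -> {RV P >-> R}.
   R^n is 'rV[R]_n and R_+^n is 'rV[{posnum R}]_n, so that fields on R_+^n are
   defined exactly at the vectors with positive coordinates. *)

Section finite_dimensional_distributions.
Context d (Omega : measurableType d) (R : realType) (P : probability Omega R).
Context (I : Type).
Implicit Type X : I -> {RV P >-> R}.

Definition field_vector X k (t : k.-tuple I) (w : Omega) : k.-tuple R :=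
  [tuple X (tnth t i) w | i < k].

Lemma measurable_field_vector X k (t : k.-tuple I) :
  measurable_fun [set: Omega] (field_vector X t).
Proof.
apply/measurable_fun_tnthP => i.
have -> : @tnth k R ^~ i \o field_vector X t = X (tnth t i).
  by apply/funext => w; rewrite /= tnth_mktuple.
exact: measurable_funPT.
Qed.

HB.instance Definition _ X k (t : k.-tuple I) :=
  isMeasurableFun.Build _ _ _ _ (field_vector X t) (measurable_field_vector X t).

(* The joint laws live on k.-tuple R with its product sigma-algebra; they are
   compared on measurable sets only, since [distribution] is a function on all
   sets whose values elsewhere carry no meaning. *)
Definition same_fdd X Y :=
  forall k (t : k.-tuple I) (A : set (k.-tuple R)), measurable A ->
    distribution P (field_vector X t) A = distribution P (field_vector Y t) A.

End finite_dimensional_distributions.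

Section fields.
Context d (Omega : measurableType d) (R : realType) (P : probability Omega R).
Context (n : nat).

Definition stationary (X : 'rV[R]_n -> {RV P >-> R}) :=
  forall u : 'rV[R]_n, same_fdd (fun t => X (t + u)) X.

Definition pos_scale (c : {posnum R}) (t : 'rV[{posnum R}]_n) :
    'rV[{posnum R}]_n :=
  map_mx (fun x : {posnum R} => (c%:num * x%:num)%:pos) t.

Definition self_similar (H : R) (Y : 'rV[{posnum R}]_n -> {RV P >-> R}) :=
  forall c : {posnum R},
    same_fdd (fun t => Y (pos_scale c t))
             (fun t => scale_mfun (c%:num `^ H) (Y t)).

(* The library's norm on 'rV[R]_n is the sup norm, hence this definition. *)
Definition euclidean_norm (x : 'rV[R]_n) : R :=
  Num.sqrt (\sum_(i < n) x 0 i ^+ 2).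

Definition lamperti (H : R) (X : 'rV[R]_n -> {RV P >-> R})
    (t : 'rV[{posnum R}]_n) : {RV P >-> R} :=
  scale_mfun (euclidean_norm (\row_i (t 0 i)%:num) `^ H)
             (X (\row_i ln (t 0 i)%:num)).

End fields.

(* Main.v *)
Require Import Defs.
From mathcomp Require Import all_boot all_order all_algebra.
From mathcomp Require Import all_classical all_reals all_analysis.
From mathcomp Require Import measurable_realfun.

Set Implicit Arguments.
Unset Strict Implicit.
Unset Printing Implicit Defensive.

Import Order.TTheory GRing.Theory Num.Theory.
Local Open Scope ring_scope.

(** Coordinatewise [ln] turns the dilation of $t$ by $c$ into a translation by $\ln c$, and the
    Euclidean norm is homogeneous, so $Y(ct) = c^H \Vert t\Vert^H X(\ln t + \ln c)$. Stationarity
    removes the shift in law, leaving $c^H Y(t)$; by [same_fdd_scale_comp] the deterministic weight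
    and the reindexing by [ln] respect this equality of laws. *)

(* Exposes [field_vector] as a plain function: rewriting under [distribution]
   itself leaves the canonical random-variable structure unchanged. *)
Lemma distribution_field_vector (R : realType) (d : measure_display)
    (Omega : measurableType d) (P : probability Omega R) (I : Type)
    (X : I -> {RV P >-> R}) (k : nat) (t : k.-tuple I) (A : set (k.-tuple R)) :
  distribution P (field_vector X t) A =
  P ((field_vector X t : Omega -> k.-tuple R) @^-1` A)%classic.
Proof. by []. Qed.

(** Both new vectors are images of the old ones, sampled at [map_tuple g t], under one measurable
    map [phi], so an event [A] pulls back to the same measurable set for [X] and [X']. *)
Lemma same_fdd_scale_comp (R : realType) (d : measure_display)
    (Omega : measurableType d) (P : probability Omega R) (I J : Type)
    (X X' : I -> {RV P >-> R}) (g : J -> I) (a : J -> R) :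
  same_fdd (P := P) X X' ->
  same_fdd (P := P) (fun j => scale_mfun (a j) (X (g j)))
                    (fun j => scale_mfun (a j) (X' (g j))).
Proof.
move=> XX' k t A mA.
pose phi (v : k.-tuple R) : k.-tuple R :=
  [tuple tnth v i * a (tnth t i) | i < k].
have mphi : measurable_fun setT phi.
  apply/measurable_fun_tnthP => i.
  have -> : @tnth k R ^~ i \o phi = (fun v => tnth v i * a (tnth t i)).
    by apply/funext => v; rewrite /= tnth_mktuple.
  by apply: measurable_funM => //; exact: measurable_tnth.
have phiE (Z : I -> {RV P >-> R}) :
    field_vector (P := P) (fun j => scale_mfun (a j) (Z (g j))) t =
    phi \o field_vector Z (map_tuple g t) :> (Omega -> k.-tuple R).
  by apply/funext => w; apply: eq_from_tnth => i; rewrite !tnth_mktuple tnth_map.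
have mphiA : measurable (phi @^-1` A)%classic.
  by rewrite -[X in measurable X]setTI; exact: mphi.
have := XX' k (map_tuple g t) _ mphiA.
by rewrite !distribution_field_vector !phiE.
Qed.

(** Pointwise equality avoids comparing random variables as records bundled with measurability
    proofs. *)
Lemma eq_same_fdd (R : realType) (d : measure_display)
    (Omega : measurableType d) (P : probability Omega R) (I : Type)
    (X X' Y Y' : I -> {RV P >-> R}) :
  (forall i, X i =1 X' i) -> (forall i, Y i =1 Y' i) ->
  same_fdd (P := P) X Y -> same_fdd (P := P) X' Y'.
Proof.
move=> eqX eqY XY k t A mA.
have fvE (Z Z' : I -> {RV P >-> R}) : (forall i, Z i =1 Z' i) ->
    field_vector (P := P) Z' t = field_vector (P := P) Z t
      :> (Omega -> k.-tuple R).
  move=> eqZ; apply/funext => w; apply: eq_from_tnth => i.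
  by rewrite !tnth_mktuple eqZ.
have := XY k t A mA.
by rewrite !distribution_field_vector (fvE _ _ eqX) (fvE _ _ eqY).
Qed.

Lemma euclidean_normZ (R : realType) (n : nat) (c : R) (x : 'rV[R]_n) :
  0 <= c -> euclidean_norm (c *: x) = c * euclidean_norm x.
Proof.
move=> c0; rewrite /euclidean_norm.
under eq_bigr do rewrite mxE exprMn.
by rewrite -mulr_sumr sqrtrM ?sqr_ge0// sqrtr_sqr ger0_norm.
Qed.

(* Coordinatewise, [ln (c * t) = ln t + ln c], so scaling [t] by [c] translates
   the argument of [X] by the constant vector [ln c]. *)
Theorem proposition5p1 (R : realType) (d : measure_display)
    (Omega : measurableType d) (P : probability Omega R) (n : nat)
    (X : 'rV[R]_n -> {RV P >-> R}) (H : R) :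
  (1 <= n)%N -> stationary X -> 0 < H -> self_similar H (lamperti H X).
Proof.
move=> _ statX _ c.
pose num (t : 'rV[{posnum R}]_n) : 'rV[R]_n := \row_i (t 0 i)%:num.
pose lnv (t : 'rV[{posnum R}]_n) : 'rV[R]_n := \row_i ln (t 0 i)%:num.
(* The common weight of both sides: $Y(ct)$ is [a t] times the shifted field at [lnv t], and $c^H
   Y(t)$ is [a t] times [X (lnv t)]. *)
pose a t := c%:num `^ H * euclidean_norm (num t) `^ H.
have scaleE t : num (pos_scale c t) = c%:num *: num t.
  by apply/rowP => i; rewrite !mxE.
have lnE t : lnv (pos_scale c t) = lnv t + const_mx (ln c%:num).
  by apply/rowP => i; rewrite !mxE /= lnM ?posrE// addrC.
have XY := same_fdd_scale_comp lnv a (statX (const_mx (ln c%:num))).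
apply: eq_same_fdd XY => t w.
  rewrite /lamperti /= -/(num _) -/(lnv _) scaleE lnE euclidean_normZ//.
  by rewrite powRM// sqrtr_ge0.
by rewrite /lamperti /= -mulrA; congr (_ * _); exact: mulrC.
Qed.
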